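(* Let $n\ge 1$, let $A$ be a compact set in $\mathbb{R}^n$ and let $k\ge 1$ be an integer. Then $$c\left(A(k+1)\right)\le\frac{k}{k+1}\,c\left(A(k)\right).$$
   Context: For a compact set $A\subset\mathbb{R}^n$ and a positive integer $k$, the Minkowski average is $$A(k) = \left\{\frac{a_1+\cdots+a_k}{k} : a_1,\ldots,a_k\in A\right\}.$$ $\mathrm{conv}(A)$ is the convex hull of $A$, and for sets $A,B\subset\mathbb{R}^n$ and $\lambda\ge 0$, $A+\lambda B = \{a+\lambda b : a\in A,\ b\in B\}$. Schneider's non-convexity index of a compact set $A\subset\mathbb{R}^n$ is $$c(A) = \inf\{\lambda\ge 0 : A+\lambda\,\mathrm{conv}(A)\text{ is convex}\}.$$ *)

(* Defs.v *)
From HB Require Import structures.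
From mathcomp Require Import all_boot all_order all_algebra.
From mathcomp Require Import all_classical all_reals all_analysis.
Import Order.TTheory GRing.Theory Num.Theory.
Set Implicit Arguments.
Unset Strict Implicit.
Unset Printing Implicit Defensive.
Local Open Scope classical_set_scope.
Local Open Scope ring_scope.

Definition minkowski_average (R : realType) (n : nat) (A : set 'rV[R]_n)
    (k : nat) : set 'rV[R]_n :=
  [set k%:R^-1 *: (\sum_(i < k) a i) |
    a in [set a : 'I_k -> 'rV[R]_n | forall i, A (a i)]].

Definition convex_hull (R : realType) (n : nat) (A : set 'rV[R]_n) :
    set 'rV[R]_n :=
  smallest (@convex_set R 'rV[R]_n) A.

Definition minkowski_comb (R : realType) (n : nat) (A : set 'rV[R]_n)
    (l : R) (B : set 'rV[R]_n) : set 'rV[R]_n :=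
  [set a + l *: b | a in A & b in B].

(* The infimum is over a set of reals bounded below by 0; by Carathéodory's
   theorem that set contains n, so [inf] never takes its default value. *)
Definition nonconvexity_index (R : realType) (n : nat) (A : set 'rV[R]_n) : R :=
  inf [set l : R | 0 <= l /\
         convex_set (minkowski_comb A l (convex_hull A))].

(* Main.v *)
Require Import Defs.
From mathcomp Require Import all_boot all_order all_algebra.
From mathcomp Require Import all_classical all_reals all_analysis.
From mathcomp Require Import ring lra.
Import Order.TTheory GRing.Theory Num.Theory.
Import numFieldNormedType.Exports.
Local Open Scope classical_set_scope.
Local Open Scope ring_scope.

(** Write C for the convex hull of A, which is also the convex hull of every
    average A(k).  The hull of D + l C(D) is (1 + l) C(D), so that sum is
    convex exactly when it already fills (1 + l) C(D), i.e. when every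
    (1 + l) c splits as d + l b; this is the predicate [exhausts D l]
    ([convex_minkowski_combP]).

    The heart of the argument is [exhausts_minkowski_averageS]: if A(k)
    exhausts its hull at l, then A(k+1) does at k l / (k+1).  Clearing
    denominators, one must write k (1 + l) c + c as a sum of k + 1 points of A
    plus an element of k l C.  The hypothesis at c gives
      k (1 + l) c = a_0 + (a_1 + ... + a_(k-1)) + k l b.
    Keep a_0 and put c in its place: the k points a_1, ..., a_(k-1), c of C
    together with k l b add up to k (1 + l) d for some d in C.  The hypothesis
    at d turns this into k points of A plus an element of k l C, and with a_0
    that makes k + 1 points of A.

    Passing to the infimum over l requires that some l be admissible for A(k),
    since the infimum of the empty set is 0 by convention.
    Carathéodory's theorem provides l = n ([exhausts_dim]): in a convex
    combination of at most n + 1 points one weight is at least 1 / (n + 1), so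
    that (n + 1) c minus that point is n times a point of the hull. *)

(** * Convex sets and convex hulls *)

Lemma convex_setP {R : realType} {n : nat} (D : set 'rV[R]_n) :
  convex_set D <->
  (forall x y t, D x -> D y -> 0 <= t -> t <= 1 ->
     D (t *: x + (1 - t) *: y)).
Proof.
split=> [cD x y t Dx Dy t0 t1|cD x y t /set_mem Dx /set_mem Dy]; last first.
  by apply/mem_set; apply: cD.
have t01 : Itv.spec (@Itv.num_sem R) (Itv.Real `[0%Z, 1%Z]) t.
  by rewrite /Itv.spec /Itv.num_sem /= in_itv /= t0 t1 ger0_real.
by have := cD x y (Itv.mk t01) (mem_set Dx) (mem_set Dy) => /set_mem.
Qed.

Lemma convex_hull_convex {R : realType} {n : nat} (A : set 'rV[R]_n) :
  convex_set (convex_hull A).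
Proof.
apply/convex_setP => x y t Ax Ay t0 t1 D [cD AD].
by move/convex_setP: (cD); apply => //; [apply: Ax | apply: Ay].
Qed.

Lemma sub_convex_hull {R : realType} {n : nat} (A : set 'rV[R]_n) :
  A `<=` convex_hull A.
Proof. exact: sub_gen_smallest. Qed.

Lemma convex_hull_min {R : realType} {n : nat} (A D : set 'rV[R]_n) :
  convex_set D -> A `<=` D -> convex_hull A `<=` D.
Proof. exact: smallest_sub. Qed.

(** The homogeneous form of convexity, s D + t D = (s + t) D: combinations can
    be chained in it without rescaling their weights at each step. *)
Lemma convex_set_comb2 {R : realType} {n : nat} (D : set 'rV[R]_n) x y s t :
  convex_set D -> D x -> D y -> 0 <= s -> 0 <= t ->
  exists2 d, D d & s *: x + t *: y = (s + t) *: d.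
Proof.
move=> /convex_setP cD Dx Dy s0 t0.
have [st0|stN0] := eqVneq (s + t) 0.
  exists x => //; have [-> ->] : s = 0 /\ t = 0 by split; lra.
  by rewrite !scale0r !addr0 scale0r.
have st_gt0 : 0 < s + t by rewrite lt_def stN0 addr_ge0.
exists ((s / (s + t)) *: x + (1 - s / (s + t)) *: y).
  by apply: cD; rewrite ?divr_ge0 ?ler_pdivrMr ?mul1r ?lerDl ?addr_ge0.
by rewrite scalerDr !scalerA; congr (_ *: _ + _ *: _); field.
Qed.

Lemma convex_set_comb {R : realType} {n : nat} (D : set 'rV[R]_n)
    (m : nat) (w : 'I_m -> R) (a : 'I_m -> 'rV[R]_n) :
  convex_set D -> D !=set0 -> (forall i, 0 <= w i) -> (forall i, D (a i)) ->
  exists2 d, D d & \sum_i w i *: a i = (\sum_i w i) *: d.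
Proof.
move=> cD [d0 Dd0] w0 Da.
suff [_ [d Dd dE]] : 0 <= \sum_i w i /\
    exists2 d, D d & \sum_i w i *: a i = (\sum_i w i) *: d by exists d.
elim/big_ind2: _ => [|x s y t [s0 [d Dd ->]] [t0 [e De ->]]|i _].
- by split=> //; exists d0; rewrite ?scale0r.
- have [f Df ->] := convex_set_comb2 D d e s t cD Dd De s0 t0.
  by split; [exact: addr_ge0 | exists f].
- by split=> //; exists (a i).
Qed.

(** * Carathéodory's theorem *)

(** Weights as a row vector and points as the rows of a matrix: concatenating
    two combinations is then a block product, and discarding a point
    removes one column and one row. *)
Definition is_combination {R : realType} {n : nat} (A : set 'rV[R]_n)
    (m : nat) (x : 'rV[R]_n) : Prop :=
  exists (w : 'rV[R]_m) (M : 'M[R]_(m, n)),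
    [/\ forall i, 0 <= w 0 i, \sum_i w 0 i = 1, forall i, A (row i M)
      & x = w *m M].

(** Combinations of points of A form a convex set: the concatenation of two
    of them, with weights rescaled by t and 1 - t, is again one. *)
Lemma convex_hull_combination {R : realType} {n : nat} (A : set 'rV[R]_n) x :
  convex_hull A x -> exists m, is_combination A m x.
Proof.
move: x; apply: convex_hull_min => [|a Aa]; last first.
  exists 1%N, (const_mx 1), a; split=> [i||i|].
  - by rewrite mxE.
  - by rewrite big_ord1 mxE.
  - by rewrite row_id.
  - by rewrite [const_mx 1]mx11_scalar mxE mul1mx.
apply/convex_setP => x y t [p [v [M [v0 v1 AM ->]]]] [q [w [N [w0 w1 AN ->]]]].
move=> t0 t1; exists (p + q)%N, (row_mx (t *: v) ((1 - t) *: w)), (col_mx M N).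
split=> [i||i|].
- rewrite -(splitK i); case: (fintype.split i) => j /=.
    by rewrite row_mxEl mxE mulr_ge0.
  by rewrite row_mxEr mxE mulr_ge0// subr_ge0.
- rewrite big_split_ord /=.
  under eq_bigr do rewrite row_mxEl mxE.
  under [X in _ + X]eq_bigr do rewrite row_mxEr mxE.
  by rewrite -!mulr_sumr v1 w1; ring.
- rewrite -(splitK i); case: (fintype.split i) => j /=.
    by rewrite rowKu.
  by rewrite rowKd.
- by rewrite mul_row_col !scalemxAl.
Qed.

(** Appending a column of ones to M turns an affine dependency of its rows
    into a linear one, and n + 1 columns are too few for m + 1 independent
    rows.  A nonzero v of zero sum has a positive entry. *)
Lemma affine_dependency {R : realType} {n m : nat} (M : 'M[R]_(m.+1, n)) :
  (n < m)%N ->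
  exists v : 'rV[R]_m.+1,
    [/\ v *m M = 0, \sum_i v 0 i = 0 & exists i, 0 < v 0 i].
Proof.
move=> nm; pose N := row_mx M (const_mx 1 : 'cV[R]_m.+1).
have : kermx N != 0.
  rewrite kermx_eq0 /row_free neq_ltn.
  by rewrite (leq_ltn_trans (rank_leq_col _))// addn1 ltnS.
case/rowV0Pn => v /sub_kermxP vN vn0.
move: vN; rewrite mul_mx_row => /eqP; rewrite row_mx_eq0 => /andP[/eqP vM v1].
have {}v1 : \sum_i v 0 i = 0.
  have -> : \sum_i v 0 i = (v *m (const_mx 1 : 'cV[R]_m.+1)) 0 0.
    by rewrite mxE; apply: eq_bigr => i _; rewrite mxE mulr1.
  by rewrite (eqP v1) mxE.
exists v; split=> //; apply: contrapT => /forallNP vle0.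
have {}vle0 i : v 0 i <= 0 by rewrite leNgt; apply/negP/vle0.
case/negP: vn0; apply/eqP/rowP => i; rewrite mxE.
apply/eqP; rewrite -oppr_eq0; apply/eqP.
have := @psumr_eq0P _ _ predT (fun i => - v 0 i).
by apply => // [j _|]; rewrite ?oppr_ge0// sumrN v1 oppr0.
Qed.

(** Moving the weights along an affine dependency changes neither the point
    nor the total weight; the move stops when the first weight reaches 0, and
    the corresponding point is dropped. *)
Lemma is_combination_pred {R : realType} {n : nat} (A : set 'rV[R]_n)
    (m : nat) x :
  (n < m)%N -> is_combination A m.+1 x -> is_combination A m x.
Proof.
move=> nm [w [M [w0 w1 AM ->]]].
have [v [vM v1 [i0 vi0]]] := affine_dependency M nm.
have [j vj jmin] := @arg_minP _ R _ i0 (fun i => 0 < v 0 i)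
  (fun i => w 0 i / v 0 i) vi0.
(* The largest multiple of v that keeps all the weights nonnegative. *)
pose u := w - (w 0 j / v 0 j) *: v.
have uj : u 0 j = 0 by rewrite !mxE; field; rewrite gt_eqF.
have u0 i : 0 <= u 0 i.
  rewrite !mxE subr_ge0; have [vi|vi] := ltP 0 (v 0 i).
    by rewrite -ler_pdivlMr// jmin.
  apply: le_trans (w0 i).
  by rewrite mulr_ge0_le0// divr_ge0// ltW.
have u1 : \sum_i u 0 i = 1.
  under eq_bigr do rewrite !mxE.
  by rewrite sumrB -mulr_sumr v1 mulr0 subr0.
have -> : w *m M = u *m M by rewrite mulmxBl -scalemxAl vM scaler0 subr0.
exists (col' j u), (row' j M); split=> [i||i|].
- by rewrite mxE.
- under eq_bigr do rewrite mxE.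
  by rewrite -u1 [RHS](bigD1_ord j)//= uj add0r.
- suff -> : row i (row' j M) = row (lift j i) M by [].
  by apply/rowP => c; rewrite !mxE.
- apply/rowP => c; rewrite !mxE (bigD1_ord j)//= uj mul0r add0r.
  by apply: eq_bigr => i _; rewrite !mxE.
Qed.

Lemma caratheodory {R : realType} {n : nat} (A : set 'rV[R]_n) x :
  convex_hull A x -> exists2 m, (m <= n.+1)%N & is_combination A m x.
Proof.
case/convex_hull_combination; elim=> [|m IH] Am; first by exists 0%N.
have [nm|mn] := ltnP n m; last by exists m.+1.
exact/IH/is_combination_pred.
Qed.

(** * Sets exhausting their convex hull *)

(** The inclusion of (1 + l) conv(D) in D + l conv(D); the reverse inclusion
    always holds for l >= 0. *)
Definition exhausts {R : realType} {n : nat} (D : set 'rV[R]_n) (l : R) :=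
  forall c, convex_hull D c ->
  exists d b, [/\ D d, convex_hull D b & (1 + l) *: c = d + l *: b].

(** If the sum is convex, the points c with (1 + l) c in the sum form a convex
    set, which contains D because (1 + l) d = d + l d; hence it contains the
    hull.  Conversely the sum equals a dilate of the hull. *)
Lemma convex_minkowski_combP {R : realType} {n : nat} (D : set 'rV[R]_n) l :
  0 <= l ->
  convex_set (minkowski_comb D l (convex_hull D)) <-> exhausts D l.
Proof.
move=> l0; split=> [/convex_setP cD|exD].
  apply: convex_hull_min => [|d Dd]; last first.
    by exists d, d; split; [|exact: sub_convex_hull|rewrite scalerDl scale1r].
  apply/convex_setP => x y t [d [b [Dd Db xE]]] [e [f [De Df yE]]] t0 t1.
  have [] := cD ((1 + l) *: x) ((1 + l) *: y) t _ _ t0 t1.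
  - by exists d => //; exists b.
  - by exists e => //; exists f.
  move=> g Dg [h Dh ghE]; exists g, h; split=> //.
  rewrite ghE scalerDr !scalerA.
  by congr (_ *: _ + _ *: _); ring.
have sumE x : minkowski_comb D l (convex_hull D) x ->
    exists2 c, convex_hull D c & x = (1 + l) *: c.
  case=> d Dd [b Db <-].
  have [c Dc cE] := convex_set_comb2 (convex_hull D) d b 1 l
    (convex_hull_convex D) (sub_convex_hull D d Dd) Db ler01 l0.
  by exists c; rewrite -?cE ?scale1r.
apply/convex_setP => _ _ t /sumE[c Dc ->] /sumE[d Dd ->] t0 t1.
have De : convex_hull D (t *: c + (1 - t) *: d).
  by have /convex_setP := convex_hull_convex D; apply.
have [a [b [Da Db abE]]] := exD _ De.
exists a => //; exists b => //; rewrite -abE scalerDr !scalerA.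
by congr (_ *: _ + _ *: _); ring.
Qed.

(** A Carathéodory representation of c has a weight at least 1 / (n + 1); the
    corresponding point, taken with coefficient 1, can be subtracted from
    (n + 1) c and leaves nonnegative coefficients of total n. *)
Lemma exhausts_dim {R : realType} {n : nat} (D : set 'rV[R]_n) :
  exhausts D n%:R.
Proof.
move=> c Dc; have [[|m] mn [w [M [w0 w1 DM cE]]]] := caratheodory D c Dc.
  by move/eqP: w1; rewrite big_ord0 eq_sym oner_eq0.
have [i wi] : exists i, 1 <= (1 + n%:R) * w 0 i.
  apply: contrapT => /forallNP wlt.
  have : \sum_i (1 + n%:R) * w 0 i < \sum_(i < m.+1) 1.
    apply: ltr_sum => [|i _]; last by rewrite ltNge; apply/negP/wlt.
    by apply/hasP; exists ord0; rewrite ?mem_index_enum.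
  rewrite -mulr_sumr w1 mulr1 sumr_const card_ord.
  by rewrite nat1r ltr_nat ltnNge mn.
(* The coefficients of (n + 1) c - row i M. *)
pose u j : R := (1 + n%:R) * w 0 j - (j == i)%:R.
have u0 j : 0 <= u j.
  rewrite /u; have [->|_] := eqVneq j i; first by rewrite subr_ge0.
  by rewrite subr0 mulr_ge0// addr_ge0.
have DMh j : convex_hull D (row j M) by apply: sub_convex_hull.
have [b Db bE] := convex_set_comb (convex_hull D) m.+1 u (fun j => row j M)
  (convex_hull_convex D) (ex_intro _ c Dc) u0 DMh.
have delta_sum : \sum_j (j == i)%:R = 1 :> R.
  by rewrite (bigD1 i)//= eqxx big1 ?addr0// => j /negbTE ->.
have delta_row : \sum_j (j == i)%:R *: row j M = row i M.
  rewrite (bigD1 i)//= eqxx scale1r big1 ?addr0// => j /negbTE ->.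
  by rewrite scale0r.
exists (row i M), b; split=> //.
have uE : \sum_j u j = n%:R.
  by rewrite sumrB -mulr_sumr w1 delta_sum; ring.
rewrite -[X in _ + X *: b]uE -bE; under eq_bigr do rewrite /u scalerBl -scalerA.
rewrite sumrB delta_row -scaler_sumr [RHS]addrC subrK.
by rewrite cE mulmx_sum_row.
Qed.

(** * Minkowski averages *)

Lemma sub_minkowski_average {R : realType} {n : nat} (A : set 'rV[R]_n) k :
  (0 < k)%N -> A `<=` minkowski_average A k.
Proof.
move=> k0 a Aa; exists (fun=> a) => //.
rewrite sumr_const card_ord -(scaler_nat k a) scalerA mulVf ?scale1r//.
by rewrite pnatr_eq0 -lt0n.
Qed.

Lemma minkowski_averageP {R : realType} {n : nat} (A : set 'rV[R]_n) k x :
  minkowski_average A k.+1 x <->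
  exists2 a : 'I_k.+1 -> 'rV[R]_n, (forall i, A (a i)) &
    k.+1%:R *: x = \sum_i a i.
Proof.
have kN0 : k.+1%:R != 0 :> R by rewrite pnatr_eq0.
split=> [[a Aa <-]|[a Aa xE]]; exists a => //.
  by rewrite scalerA divff ?scale1r.
by rewrite -xE scalerA mulVf ?scale1r.
Qed.

Lemma convex_hull_minkowski_average {R : realType} {n : nat}
    (A : set 'rV[R]_n) k :
  (0 < k)%N -> convex_hull (minkowski_average A k) = convex_hull A.
Proof.
case: k => // k _; apply/seteqP; split; last first.
  apply: convex_hull_min; first exact: convex_hull_convex.
  by move=> a Aa; apply: sub_convex_hull; exact: sub_minkowski_average.
apply: convex_hull_min => [|x /minkowski_averageP[a Aa xE]].
  exact: convex_hull_convex.
have Aah i : convex_hull A (a i) by apply: sub_convex_hull.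
have [d Ad dE] := convex_set_comb (convex_hull A) k.+1 (fun=> 1) a
  (convex_hull_convex A) (ex_intro _ _ (Aah ord0)) (fun=> ler01) Aah.
suff -> : x = d by [].
apply: (@scalerI _ _ k.+1%:R); first by rewrite pnatr_eq0.
rewrite xE; move: dE; rewrite sumr_const card_ord => <-.
by apply: eq_bigr => i _; rewrite scale1r.
Qed.

(** The exchange step: one point of A is set aside, and c takes its place
    before the hypothesis is applied a second time. *)
Lemma exhausts_minkowski_averageS {R : realType} {n : nat}
    (A : set 'rV[R]_n) k l :
  0 <= l -> exhausts (minkowski_average A k.+1) l ->
  exhausts (minkowski_average A k.+2) (k.+1%:R / k.+2%:R * l).
Proof.
move=> l0; rewrite /exhausts !convex_hull_minkowski_average// => exA c Ac.
have cA := convex_hull_convex A.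
have k2N0 : k.+2%:R != 0 :> R by rewrite pnatr_eq0.
have [x [b [/minkowski_averageP[a Aa xE] Ab abE]]] := exA c Ac.
have Aah i : convex_hull A (a i) by apply: sub_convex_hull.
(* e is the mean of all the a i except a ord0; when k = 0 its weight is 0. *)
have [e Ae eE] := convex_set_comb (convex_hull A) k (fun=> 1)
  (fun i => a (lift ord0 i)) cA (ex_intro _ c Ac) (fun=> ler01)
  (fun i => Aah _).
(* f is the mean of the same points with c in place of a ord0. *)
have [f Af fE] := convex_set_comb2 _ e c k%:R 1 cA Ae Ac (ler0n _ _) ler01.
have [d Ad dE] := convex_set_comb2 _ f b 1 l cA Af Ab ler01 l0.
have [y [b' [/minkowski_averageP[a' Aa' yE] Ab' abE']]] := exA d Ad.
pose g i := if unlift ord0 i is Some j then a' j else a ord0.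
have gA i : A (g i) by rewrite /g; case: (unlift _ _).
exists (k.+2%:R^-1 *: \sum_i g i), b'; split=> //.
  by apply/minkowski_averageP; exists g => //; rewrite scalerA divff ?scale1r.
apply: (scalerI k2N0).
have aE : \sum_i a i = a ord0 + k%:R *: e.
  rewrite big_ord_recl; congr (_ + _).
  move: eE; rewrite sumr_const card_ord => <-.
  by apply: eq_bigr => i _; rewrite scale1r.
have gE : \sum_i g i = a ord0 + k.+1%:R *: y.
  rewrite big_ord_recl yE /g unlift_none; congr (_ + _).
  by apply: eq_bigr => i _; rewrite liftK.
have -> : k.+2%:R *: ((1 + k.+1%:R / k.+2%:R * l) *: c)
    = k.+1%:R *: ((1 + l) *: c) + c.
  rewrite -[X in _ = _ + X]scale1r !scalerA -scalerDl; congr (_ *: _).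
  by rewrite -!natr1 in k2N0 *; field.
rewrite abE scalerDr xE aE.
have -> : a ord0 + k%:R *: e + k.+1%:R *: (l *: b) + c
    = a ord0 + k.+1%:R *: ((1 + l) *: d).
  by rewrite -dE scalerDr scale1r -natr1 -fE scale1r !addrA [LHS]addrAC.
rewrite abE' [in RHS]scalerDr [in RHS]scalerA divff// scale1r gE scalerDr addrA.
by congr (_ + _); rewrite !scalerA; congr (_ *: _); field.
Qed.

Theorem theorem1p2 (R : realType) (n : nat) (hn : (1 <= n)%N)
    (A : set 'rV[R]_n) (hA : compact A) (k : nat) (hk : (1 <= k)%N) :
  nonconvexity_index (minkowski_average A k.+1)
    <= k%:R / k.+1%:R * nonconvexity_index (minkowski_average A k).
Proof.
case: k hk => // k _.
(* Dividing by the ratio reduces the claim to a lower bound on an infimum. *)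
have r_gt0 : 0 < k.+1%:R / k.+2%:R :> R by rewrite divr_gt0 ?ltr0n.
rewrite mulrC -ler_pdivrMr//; apply: lb_le_inf.
  exists n%:R; split; first exact: ler0n.
  by apply/convex_minkowski_combP; [exact: ler0n | exact: exhausts_dim].
move=> l [l0 /(convex_minkowski_combP _ _ l0) exA].
rewrite ler_pdivrMr// mulrC; apply: ge_inf; first by exists 0 => ? [].
have rl0 : 0 <= k.+1%:R / k.+2%:R * l by rewrite mulr_ge0// ltW.
split=> //; apply/convex_minkowski_combP => //.
exact: exhausts_minkowski_averageS.
Qed.
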